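(* Let $h$ be the fractal interpolation function described in the context and let $\beta>0$. Then ${}_{x_1}\mathfrak{I}^{\beta}h$ is the fractal interpolation function associated to the IFS $\mathcal{J}_1=\{J\times\mathbb{R}^M;H_1,\dots,H_{N-1}\}$ with data set $\{(x_i,{}_{x_1}\mathfrak{I}^{\beta}h(x_i)):i\in\{1,\dots,N\}\}$, where for $k\in T$ $$H_k(t,\boldsymbol{z})=(P_k(t),F'_k(t,\boldsymbol{z})),\qquad P_k(t)=a_kt+d_k,\qquad F'_k(t,\boldsymbol{z})=a_k^{\beta}\alpha_k\boldsymbol{z}+Q_k(t),$$ and $Q_k=(Q_{k,1},\dots,Q_{k,M})$ is the vector-valued continuous function on $J$ given, for $i\in\{1,\dots,M\}$, by $$Q_{k,i}(t)=\frac{1}{\Gamma(\beta)}\int_{x_1}^{P_k(x_1)}(P_k(t)-\eta)^{\beta-1}h_i(\eta)\,d\eta+\frac{a_k^{\beta}}{\Gamma(\beta)}\int_{x_1}^{t}(t-\eta)^{\beta-1}q_{k,i}(\eta)\,d\eta.$$ Furthermore, if $(p_1,\dots,p_{N-1})$ is a probability vector corresponding to the IFS $\mathcal{J}_1$, then there exists a unique Borel probability measure $\mu^*$ supported on the graph $G({}_{x_1}\mathfrak{I}^{\beta}h)$ such that $$\mu^*=\sum_{k\in T}p_k\,\mu^*\circ H_k^{-1}.$$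
   Context: Setting: $M\ge 1$, $(x_i,\boldsymbol{y}_i)\in\mathbb{R}\times\mathbb{R}^M$ ($i=1,\dots,N$) are data points with $x_1<x_2<\dots<x_N$, $T=\{1,\dots,N-1\}$, $J=[x_1,x_N]$, $J_k=[x_k,x_{k+1}]$. For $k\in T$, $P_k(t)=a_kt+d_k$ is the affine map $J\to J_k$ with $P_k(x_1)=x_k$, $P_k(x_N)=x_{k+1}$; each $P_k$ is contractive (so $N\ge 3$). For $k\in T$, $\alpha_k\in(-1,1)$ and $q_k=(q_{k,1},\dots,q_{k,M}):J\to\mathbb{R}^M$ is continuous with $q_k(x_1)=\boldsymbol{y}_k-\alpha_k\boldsymbol{y}_1$, $q_k(x_N)=\boldsymbol{y}_{k+1}-\alpha_k\boldsymbol{y}_N$. With $W_k(t,\boldsymbol{z})=(P_k(t),\alpha_k\boldsymbol{z}+q_k(t))$, the IFS $\{J\times\mathbb{R}^M;W_1,\dots,W_{N-1}\}$ has a unique attractor, which is the graph of a continuous function $h=(h_1,\dots,h_M):J\to\mathbb{R}^M$, the fractal interpolation function (FIF), satisfying $h(t)=\alpha_k h(P_k^{-1}(t))+q_k(P_k^{-1}(t))$ for $t\in J_k$, $k\in T$. In general, for data $(x_i,\boldsymbol{w}_i)$, scalars $\gamma_k\in(-1,1)$ and continuous $Q_k:J\to\mathbb{R}^M$ with $Q_k(x_1)=\boldsymbol{w}_k-\gamma_k\boldsymbol{w}_1$ and $Q_k(x_N)=\boldsymbol{w}_{k+1}-\gamma_k\boldsymbol{w}_N$, the FIF associated to the IFS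 of maps $(t,\boldsymbol{z})\mapsto(P_k(t),\gamma_k\boldsymbol{z}+Q_k(t))$ with data set $\{(x_i,\boldsymbol{w}_i)\}$ is the continuous $g:J\to\mathbb{R}^M$ with $g(x_i)=\boldsymbol{w}_i$ for all $i$ whose graph is the unique attractor of the IFS, so that $g(P_k(t))=\gamma_kg(t)+Q_k(t)$ for $t\in J$, $k\in T$. The Riemann--Liouville fractional integral of order $\beta>0$ of an integrable $f=(f_1,\dots,f_M)$ on $[a,b]$ is defined componentwise by ${}_a\mathfrak{I}^{\beta}f_i(t)=\frac{1}{\Gamma(\beta)}\int_a^t(t-\eta)^{\beta-1}f_i(\eta)\,d\eta$. $G(f)$ denotes the graph of $f$. A probability vector $(p_1,\dots,p_{N-1})$ has $p_k>0$ and $\sum_{k\in T}p_k=1$. *)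

(* Defs.v *)
From mathcomp Require Import all_boot all_order all_algebra.
From mathcomp Require Import all_classical all_reals all_analysis.
Set Implicit Arguments.
Unset Strict Implicit.
Unset Printing Implicit Defensive.
Import Order.TTheory GRing.Theory Num.Theory.
Import numFieldNormedType.Exports.
Local Open Scope classical_set_scope.
Local Open Scope ring_scope.

(* Index conventions: the data are x 1, ..., x N and the maps of an IFS are
   W 1, ..., W N.-1.  Families are functions on nat of which only these values
   are ever used; likewise only the values on the interval J = [x 1, x N] of
   functions R -> 'rV[R]_M are ever used. *)

Section IteratedFunctionSystems.
Variables (R : realType) (M : nat).
Implicit Types (N : nat) (x a d : nat -> R) (w : nat -> 'rV[R]_M).

Definition map_index N : set nat := [set k | (1 <= k < N)%N].

Definition interpolation_interval N x : set R := `[x 1%N, x N].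

(* J * R^M *)
Definition ifs_space N x : set (R * 'rV[R]_M) :=
  interpolation_interval N x `*` setT.

Definition affine_map a d (k : nat) (t : R) : R := a k * t + d k.

Definition ifs_map a d (gamma : nat -> R) (Q : nat -> R -> 'rV[R]_M)
    (k : nat) (u : R * 'rV[R]_M) : R * 'rV[R]_M :=
  (affine_map a d k u.1, gamma k *: u.2 + Q k u.1).

Definition is_attractor N (X : set (R * 'rV[R]_M))
    (W : nat -> R * 'rV[R]_M -> R * 'rV[R]_M) (A : set (R * 'rV[R]_M)) : Prop :=
  [/\ A `<=` X, A !=set0, compact A
    & A = \bigcup_(k in map_index N) (W k @` A)].

Definition is_unique_attractor N X W A : Prop :=
  is_attractor N X W A /\ forall B, is_attractor N X W B -> B = A.

Definition graph_on (J : set R) (g : R -> 'rV[R]_M) : set (R * 'rV[R]_M) :=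
  [set u | J u.1 /\ u.2 = g u.1].

(* The conditions on (gamma, Q) under which the IFS
   (t, z) |-> (P_k(t), gamma_k z + Q_k(t)) interpolates the data (x_i, w_i). *)
Record fif_parameters N x w (gamma : nat -> R) (Q : nat -> R -> 'rV[R]_M)
    : Prop := {
  fif_scale : forall k, map_index N k -> -1 < gamma k < 1;
  fif_continuous : forall k, map_index N k ->
    {within interpolation_interval N x, continuous (Q k)};
  fif_left : forall k, map_index N k -> Q k (x 1%N) = w k - gamma k *: w 1%N;
  fif_right : forall k, map_index N k -> Q k (x N) = w k.+1 - gamma k *: w N }.

(* g is the fractal interpolation function associated to the IFS of the maps
   ifs_map a d gamma Q k with data set {(x_i, w_i)}. *)
Record is_fif N x w a d (gamma : nat -> R) (Q : nat -> R -> 'rV[R]_M)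
    (g : R -> 'rV[R]_M) : Prop := {
  fif_params : fif_parameters N x w gamma Q;
  fif_cont : {within interpolation_interval N x, continuous g};
  fif_interp : forall i, (1 <= i <= N)%N -> g (x i) = w i;
  fif_attractor :
    is_unique_attractor N (ifs_space N x) (ifs_map a d gamma Q)
      (graph_on (interpolation_interval N x) g) }.

End IteratedFunctionSystems.

Section FractionalIntegral.
Variable R : realType.

Definition Gamma (b : R) : R :=
  \int[lebesgue_measure]_(s in `]0, +oo[) (s `^ (b - 1) * expR (- s)).

(* Riemann-Liouville integral of order b with lower terminal c.  The value of
   the kernel at s = t is a convention of powR, irrelevant to the integral. *)
Definition RL_integral (M : nat) (c b : R) (f : R -> 'rV[R]_M) (t : R)
    : 'rV[R]_M :=
  \row_i ((Gamma b)^-1 *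
    \int[lebesgue_measure]_(s in `[c, t]) ((t - s) `^ (b - 1) * f s ord0 i)).

Definition RL_parameter (M : nat) (x a d : nat -> R) (b : R)
    (q : nat -> R -> 'rV[R]_M) (h : R -> 'rV[R]_M) (k : nat) (t : R)
    : 'rV[R]_M :=
  \row_i
    ((Gamma b)^-1 *
       \int[lebesgue_measure]_(s in `[x 1%N, affine_map a d k (x 1%N)])
          ((affine_map a d k t - s) `^ (b - 1) * h s ord0 i)
     + a k `^ b / Gamma b *
       \int[lebesgue_measure]_(s in `[x 1%N, t])
          ((t - s) `^ (b - 1) * q k s ord0 i)).

End FractionalIntegral.

Notation borel_space R M :=
  (g_sigma_algebraType (@open (R * 'rV[R]_M)%type)).

Section InvariantMeasures.
Variables (R : realType) (M : nat).

Definition is_probability_vector (N : nat) (p : nat -> R) : Prop :=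
  (forall k, map_index N k -> 0 < p k) /\ \sum_(1 <= k < N) p k = 1.

(* A is closed in the uses below, so this says that the support of mu lies
   in A. *)
Definition supported_on (mu : set (borel_space R M) -> \bar R)
    (A : set (R * 'rV[R]_M)) : Prop :=
  mu (~` A) = 0%E.

(* mu = sum_k p_k mu o (W k)^-1, where each W k is regarded as a map on X only,
   so that preimages are taken in X. *)
Definition is_invariant_measure (N : nat) (X : set (R * 'rV[R]_M))
    (W : nat -> R * 'rV[R]_M -> R * 'rV[R]_M) (p : nat -> R)
    (mu : set (borel_space R M) -> \bar R) : Prop :=
  forall B : set (borel_space R M), measurable B ->
    mu B = (\sum_(1 <= k < N) (p k)%:E * mu (X `&` (W k @^-1` B)))%E.

End InvariantMeasures.

(* Main.v *)
From HB Require Import structures.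
Require Import Defs.
From mathcomp Require Import all_boot all_order all_algebra.
From mathcomp Require Import all_classical all_reals all_analysis.
From mathcomp Require Import measurable_realfun ring lra.
Import Order.TTheory GRing.Theory Num.Theory.
Import numFieldNormedType.Exports.
Local Open Scope classical_set_scope.
Local Open Scope ring_scope.

(** Write [I] for the Riemann-Liouville integral of order [beta] with lower
    terminal [x 1], and [P k] for the affine map of the [k]-th cell.

    Functional equation.  Splitting the integral defining [I h (P k t)] at
    [x k = P k (x 1)], substituting [s := P k s] in the second piece and using
    [h (P k s) = alpha k *: h s + q k s] gives
    [I h (P k t) = (a k `^ beta * alpha k) *: I h t + Q k t] on [J]
    ([RL_integral_eq]).  Since [0 < a k < 1], the new scale factors still lie
    in ]-1, 1[, and the conditions on [Q k] at the end points are the functional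
    equation at [x 1] and [x N].  The same equation makes [Q k] continuous once
    [I h] is.  For the latter, the substitution [s := (t - c) v + c] writes the
    integral as [(t - c) `^ beta] times an integral over the fixed interval
    [0, 1], to which dominated convergence applies, the kernel
    [(1 - v) `^ (beta - 1)] being integrable ([kernel_integral_continuous]).

    Attractor.  Let [g] be a continuous solution on [J] of a functional equation
    [g (P k t) = gamma k *: g t + Q k t] with [`|gamma k| < 1].  Its graph is a
    compact invariant set because the cells cover [J].  Conversely, on a compact
    invariant set [B] the vertical distance to the graph is bounded and each map
    of the system shrinks it by a fixed factor, so [B] lies on the graph; and the
    projection of [B] to [J] is closed and, the [P k] being contractions, dense
    ([graph_is_unique_attractor]).

    Invariant measure.  The parametrization [t |-> (t, g t)] conjugates the
    system on the graph to the [P k] on [J], so everything reduces to probability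
    measures on the line.  The distribution function of such an invariant measure
    is a solution of [F t = \sum_k p k * F ((P k)^-1 t)] equal to 0 before [x 1]
    and to 1 from [x N] on.  As the cells only meet at end points, on each of
    them this operator is a constant plus [p k * F ((P k)^-1 t)] for a single
    [k]; hence it contracts the sup norm by the largest [p k], which is less
    than 1, and [F] is unique ([cdf_uniq]).  A solution is the increasing limit
    of the iterates from the indicator of [x N, +oo[; it is right-continuous
    since its right jumps are bounded by every power of that factor.  The
    Lebesgue-Stieltjes measure of [F], pushed to the graph, is the invariant
    measure ([graph_invariant_measure]). *)

Set Implicit Arguments.
Unset Strict Implicit.

(** * Affine changes of variable for the Lebesgue measure *)

Section AffineChange.
Variables (R : realType) (a d : R) (a0 : 0 < a).
Local Notation leb := (@lebesgue_measure R).
Local Notation phi := (fun t : R => a * t + d).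

Lemma measurable_affine : measurable_fun [set: measurableTypeR R]
  (phi : measurableTypeR R -> measurableTypeR R).
Proof.
apply: continuous_measurable_fun => t; apply: cvgD; last exact: cvg_cst.
by apply: cvgM; [exact: cvg_cst|exact: cvg_id].
Qed.

Let image_measure : {measure set (measurableTypeR R) -> \bar R} :=
  measure_function_pushforward__canonical__measure_function_Measure
    leb measurable_affine.

Lemma affine_preimage_itv (b1 b2 : bool) (u v : R) :
  phi @^-1` [set` Interval (BSide b1 u) (BSide b2 v)] =
  [set` Interval (BSide b1 ((u - d) / a)) (BSide b2 ((v - d) / a))].
Proof.
have lel t : (u <= phi t) = ((u - d) / a <= t).
  by rewrite ler_pdivrMr// lerBlDr mulrC.
have ltl t : (u < phi t) = ((u - d) / a < t).
  by rewrite ltr_pdivrMr// ltrBlDr mulrC.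
have ler t : (phi t <= v) = (t <= (v - d) / a).
  by rewrite ler_pdivlMr// lerBrDr mulrC.
have ltr t : (phi t < v) = (t < (v - d) / a).
  by rewrite ltr_pdivlMr// ltrBrDr mulrC.
by apply/seteqP; split => t /=; rewrite !in_itv /=; case: b1; case: b2 => /=;
  rewrite ?lel ?ltl ?ler ?ltr.
Qed.

(** The Lebesgue measure is [a] times its own image under [t |-> a t + d]: both
    measures agree on the half-open intervals. *)
Lemma lebesgue_measure_affine (A : set (measurableTypeR R)) : measurable A ->
  leb A = mscale (PosNum a0)%:num%:nng image_measure A.
Proof.
move=> mA; apply: lebesgue_measure_unique => // _ [[u v]] _ <-.
rewrite [RHS](_ : _ = (a%:E * leb (phi @^-1` `]u, v]))%E)// affine_preimage_itv.
have [uv|uv] := ltP u v.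
  rewrite !lebesgue_measure_itv /= !lte_fin uv ltr_pM2r ?invr_gt0// ltrD2r uv.
  by rewrite -!EFinD -EFinM; congr EFin; field; rewrite gt_eqF.
rewrite !set_itv_ge ?measure0 ?mule0// bnd_simp -leNgt //.
by rewrite ler_pM2r ?invr_gt0// lerD2r.
Qed.

Lemma ge0_integral_affine (D : set R) (f : R -> \bar R) :
  measurable D -> measurable_fun D f -> (forall y, D y -> (0 <= f y)%E) ->
  (\int[leb]_(y in D) f y = a%:E * \int[leb]_(t in phi @^-1` D) f (phi t))%E.
Proof.
move=> mD mf f0.
transitivity
  (\int[mscale (PosNum a0)%:num%:nng%R image_measure]_(y in D) f y)%E.
  apply: eq_measure_integral => //.
  by move=> A mA _; exact: lebesgue_measure_affine.
rewrite ge0_integral_mscale//; congr (_ * _)%E.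
rewrite ge0_integral_pushforward//; first exact: measurable_affine.
by move=> y /set_mem; exact: f0.
Qed.

Lemma measurable_preimage_affine (D : set R) :
  measurable D -> measurable (phi @^-1` D).
Proof.
by move=> mD; rewrite -[X in measurable X]setTI; exact: measurable_affine.
Qed.

Lemma measurable_fun_affine (D : set R) (f : R -> \bar R) :
  measurable D -> measurable_fun D f ->
  measurable_fun (phi @^-1` D) (fun t => f (phi t)).
Proof.
move=> mD mf; apply: (measurable_comp mD) => //.
  by move=> _ [t Dt <-].
by apply: measurable_funTS; exact: measurable_affine.
Qed.

Lemma integrable_affine (D : set R) (f : R -> \bar R) : measurable D ->
  leb.-integrable D f -> leb.-integrable (phi @^-1` D) (fun t => f (phi t)).
Proof.
move=> mD /integrableP[mf foo]; apply/integrableP; split.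
  exact: measurable_fun_affine.
move: foo; rewrite ge0_integral_affine//; last exact: measurableT_comp.
by rewrite !ltey; apply: contra_neq => ->; rewrite gt0_muley ?lte_fin.
Qed.

Lemma integrable_affineN (D : set R) (f : R -> \bar R) : measurable D ->
  measurable_fun D f ->
  leb.-integrable (phi @^-1` D) (fun t => f (phi t)) -> leb.-integrable D f.
Proof.
move=> mD mf /integrableP[mfphi foo]; apply/integrableP; split => //.
rewrite ge0_integral_affine//; last exact: measurableT_comp.
by rewrite lte_mul_pinfty// lee_fin ltW.
Qed.

Lemma integral_affine (D : set R) (f : R -> \bar R) : measurable D ->
  leb.-integrable D f ->
  (\int[leb]_(y in D) f y = a%:E * \int[leb]_(t in phi @^-1` D) f (phi t))%E.
Proof.
move=> mD intf.
have mf := measurable_int _ intf.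
rewrite [LHS]integralE [in RHS]integralE muleBr//; last first.
  apply: integrable_add_def; first exact: measurable_preimage_affine.
  exact: integrable_affine.
congr (_ - _)%E.
  rewrite ge0_integral_affine//; last exact: measurable_funepos.
  congr (_ * _)%E; apply: eq_integral => t _.
  exact/esym/(congr1 (@^~ t) (funepos_comp f phi)).
rewrite ge0_integral_affine//; last exact: measurable_funeneg.
congr (_ * _)%E; apply: eq_integral => t _.
exact/esym/(congr1 (@^~ t) (funeneg_comp f phi)).
Qed.

Lemma Rintegral_affine (D : set R) (f : R -> R) : measurable D ->
  leb.-integrable D (EFin \o f) ->
  \int[leb]_(y in D) f y = a * \int[leb]_(t in phi @^-1` D) f (phi t).
Proof.
move=> mD intf; rewrite /Rintegral integral_affine// fineM//.
apply: integrable_fin_num; first exact: measurable_preimage_affine.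
by have := @integrable_affine D (EFin \o f) mD intf.
Qed.
End AffineChange.

(** * Clamping to an interval *)

(** The retraction of the line onto [c, e] (for [c <= e]).  Composing with it
    turns functions that are continuous on [c, e] only into bounded continuous
    functions on the whole line. *)
Definition clamp {R : realType} (c e t : R) : R := Num.max c (Num.min t e).

Section Clamp.
Variables (R : realType) (c e : R) (ce : c <= e).

Lemma clamp_itv t : `[c, e]%classic (clamp c e t).
Proof. by rewrite /= in_itv/= /clamp le_max lexx/= ge_max ce/= ge_min lexx orbT. Qed.

Lemma clamp_id t : `[c, e]%classic t -> clamp c e t = t.
Proof. by rewrite /= in_itv/= => /andP[ct te]; rewrite /clamp min_l// max_r. Qed.

Lemma continuous_clamp : continuous (clamp c e).
Proof.
move=> t; apply: (@continuous_max R R (cst c) (fun t => Num.min t e)).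
  exact: cvg_cst.
by apply: (@continuous_min R R id (cst e)); [exact: cvg_id|exact: cvg_cst].
Qed.

Lemma continuous_clamp_comp (U : topologicalType) (g : R -> U) :
  {within `[c, e], continuous g} -> continuous (g \o clamp c e).
Proof.
move=> /subspace_continuousP cg t V /(cg _ (clamp_itv t)) gV.
have := @continuous_clamp t [set s | `[c, e]%classic s -> V (g s)] gV.
rewrite /= !nbhs_simpl /=.
by apply: filterS => s; apply; exact: clamp_itv.
Qed.

Lemma within_continuous_bounded (g : R -> R) :
  {within `[c, e], continuous g} ->
  exists C, forall t, `|g (clamp c e t)| <= C.
Proof.
move=> cg.
have [|||m _ hm] := @compact_EVT_max _ R (fun t => `|g t|) `[c, e]%classic.
- by exists (clamp c e c); exact: clamp_itv.
- exact: segment_compact.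
- apply: within_continuous_comp cg => t _; exact: norm_continuous.
by exists `|g m| => t; apply: hm; rewrite inE; exact: clamp_itv.
Qed.

End Clamp.

Lemma continuous_within_eq (R : realType) (U : topologicalType) (A : set R)
    (g g' : R -> U) :
  (forall t, A t -> g t = g' t) -> continuous g -> {within A, continuous g'}.
Proof.
move=> gg' cg.
apply: (@subspace_eq_continuous _ A _ (from_subspace A g)).
  by move=> t /set_mem /gg'.
exact: continuous_subspaceT.
Qed.

Lemma continuous_rV (R : realType) (M : nat) (T : topologicalType)
    (f : T -> 'rV[R]_M) :
  (forall i, continuous (fun t => f t ord0 i)) -> continuous f.
Proof.
move=> cf t A [P hP PA].
have : \forall s \near t, forall i, P ord0 i (f s ord0 i).
  by apply: filter_forall => i; exact: (cf i t _ (hP ord0 i)).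
by apply: filterS => s hs; apply: PA => i j; rewrite ord1.
Qed.

(** * The Riemann-Liouville kernel *)

(** The absolute value matters only for negative arguments, where [powR] is
    constantly 1 by convention. *)
Lemma continuous_powR_norm (R : realType) (b : R) : 0 < b ->
  continuous (fun u : R => `|u| `^ b).
Proof.
move=> b0 u.
have [->|u0] := eqVneq u 0.
  apply/cvgrPdist_lt => /= eps eps0; rewrite normr0 powR0 ?gt_eqF//.
  exists (eps `^ b^-1); first exact: powR_gt0.
  move=> /= w; rewrite sub0r normrN => hw.
  rewrite sub0r normrN ger0_norm ?powR_ge0//.
  have -> : eps = (eps `^ b^-1) `^ b.
    by rewrite -powRrM mulVf ?powRr1 ?ltW// gt_eqF.
  by rewrite gt0_ltr_powR// nnegrE ?normr_ge0// powR_ge0.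
apply: (@continuous_comp _ _ _ (fun u : R => `|u|) (@powR R ^~ b)).
  exact: norm_continuous.
have [|h _] := @is_derive1_powR R b `|u|; first by rewrite normr_gt0.
by move/derivable1_diffP/differentiable_continuous : h.
Qed.

Section Kernel.
Variables (R : realType) (b : R) (b0 : 0 < b).
Local Notation leb := (@lebesgue_measure R).

Lemma measurable_kernel (D : set R) (t : R) :
  measurable_fun D (fun s => (t - s) `^ (b - 1)).
Proof.
apply: measurable_funTS.
apply: (measurableT_comp (measurable_powR (b - 1))).
exact: measurable_funB.
Qed.

Lemma is_derive_powR_onem (v : R) : v < 1 ->
  is_derive v 1 (fun v : R => - ((1 - v) `^ b / b)) ((1 - v) `^ (b - 1)).
Proof.
move=> v1.
have h1 : is_derive (1 - v) 1 (@powR R ^~ b) (b * (1 - v) `^ (b - 1)).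
  by apply: is_derive1_powR; rewrite subr_gt0.
have h2 : is_derive v 1 (fun v : R => 1 - v) (- 1).
  have -> : -1 = 0 - 1 :> R by rewrite sub0r.
  by apply: is_deriveB.
have h3 := @is_derive1_comp R (@powR R ^~ b) (fun v : R => 1 - v) v _ _ h1 h2.
have -> : (fun v : R => - ((1 - v) `^ b / b)) =
  (- b^-1) *: ((@powR R ^~ b) \o (fun v : R => 1 - v)).
  by apply/funext => w; rewrite -[RHS]/(- b^-1 * (1 - w) `^ b) mulNr mulrC.
apply: is_derive_eq (is_deriveZ _ h3) _.
rewrite -[LHS]/(- b^-1 * (b * (1 - v) `^ (b - 1) * - 1)).
by field; rewrite gt_eqF.
Qed.

Lemma kernel_continuous (v : R) : v < 1 ->
  {for v, continuous (fun v : R => (1 - v) `^ (b - 1))}.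
Proof.
move=> v1.
have h1 : is_derive (1 - v) 1 (@powR R ^~ (b - 1))
    ((b - 1) * (1 - v) `^ (b - 1 - 1)).
  by apply: is_derive1_powR; rewrite subr_gt0.
have [h _] := h1.
apply: (@continuous_comp _ _ _ (fun v : R => 1 - v) (@powR R ^~ (b - 1))).
  by apply: cvgB; [exact: cvg_cst|exact: cvg_id].
by move/derivable1_diffP/differentiable_continuous : h.
Qed.

Lemma integral_kernel_le (u : R) : 0 < u -> u < 1 ->
  (\int[leb]_(v in `[0%R, u]) ((1 - v) `^ (b - 1))%R%:E <= (b^-1)%:E)%E.
Proof.
move=> u0 u1.
rewrite (@continuous_FTC2 R _ (fun v => - ((1 - v) `^ b / b)))//; first last.
- move=> v; rewrite in_itv/= => /andP[_ vu]; rewrite derive1E.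
  by apply: derive_val; apply: is_derive_powR_onem; exact: lt_trans vu u1.
- have dF (v : R) : v < 1 ->
      {for v, continuous (fun v : R => - ((1 - v) `^ b / b))}.
    move=> /is_derive_powR_onem[h _].
    by move/derivable1_diffP/differentiable_continuous : h.
  split.
  + move=> v; rewrite in_itv/= => /andP[_ vu].
    by have [] := is_derive_powR_onem (lt_trans vu u1).
  + by apply: cvg_at_right_filter; apply: dF.
  + by apply: cvg_at_left_filter; apply: dF.
- apply: continuous_in_subspaceT => v /set_mem /=.
  rewrite in_itv/= => /andP[_ vu].
  by apply: kernel_continuous; exact: le_lt_trans vu u1.
rewrite -EFinD lee_fin subr0 powR1 opprK mul1r gerDr oppr_le0.
by rewrite divr_ge0 ?powR_ge0// ltW.
Qed.

(** For [b < 1] the kernel is unbounded near 1; its integral over [0, 1[ is the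
    limit of its integrals over the intervals [0, 1 - 1 / (n + 2)]. *)
Lemma integrable_kernel01 :
  leb.-integrable `[0, 1] (fun v => ((1 - v) `^ (b - 1))%:E).
Proof.
have mK D : measurable_fun D (fun v : R => ((1 - v) `^ (b - 1))%:E).
  by apply/measurable_EFinP; exact: measurable_kernel.
apply/integrableP; split; first exact: mK.
under eq_integral do rewrite gee0_abs ?lee_fin ?powR_ge0//.
rewrite -integral_itv_bndo_bndc//.
pose F (n : nat) : set R := `[0, 1 - n.+2%:R^-1]%classic.
have FE : \bigcup_n F n = `[0, 1[%classic.
  apply/seteqP; split => v.
    move=> [n _]; rewrite /F /= !in_itv/= => /andP[-> h] /=.
    by rewrite (le_lt_trans h)// ltrBlDr ltrDl invr_gt0.
  rewrite /= in_itv/= => /andP[v0 v1].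
  have [n hn] := ltr_add_invr v1; exists n => //.
  rewrite /F /= in_itv/= v0/= lerBrDr (le_trans _ (ltW hn))// lerD2l.
  by rewrite lef_pV2 ?posrE// ler_nat.
have sub2 n : 1 - n.+2%:R^-1 < 1 :> R by rewrite ltrBlDr ltrDl invr_gt0.
rewrite -FE; apply: (@le_lt_trans _ _ (b^-1)%:E); last exact: ltry.
have cvF : (\int[leb]_(v in F n) ((1 - v) `^ (b - 1))%R%:E @[n --> \oo] -->
    \int[leb]_(v in \bigcup_n F n) ((1 - v) `^ (b - 1))%R%:E)%E.
  apply: ge0_nondecreasing_set_cvg_integral.
  - move=> m n mn; apply/subsetPset => v.
    rewrite /F /= !in_itv/= => /andP[->] /= /le_trans; apply.
    by rewrite lerD2l lerN2 lef_pV2 ?posrE// ler_nat !ltnS.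
  - by move=> n; exact: measurable_itv.
  - by move=> n; exact: mK.
  - by move=> n v _; rewrite lee_fin powR_ge0.
rewrite -(cvg_lim _ cvF)//.
apply: lime_le; first by apply/cvg_ex; eexists; exact: cvF.
apply: nearW => n; apply: integral_kernel_le => //.
by rewrite subr_gt0 invf_lt1// ltr1n.
Qed.

Lemma integrable_kernel (c t : R) :
  leb.-integrable `[c, t] (fun s => ((t - s) `^ (b - 1))%:E).
Proof.
wlog ct : c / c < t.
  move=> /(_ (Num.min c t - 1)) h; apply: integrableS (h _).
  - exact: measurable_itv.
  - exact: measurable_itv.
  - apply: subset_itvr; rewrite bnd_simp lerBlDr ge_min.
    by rewrite lerDl ler01.
  - by rewrite ltrBlDr gt_min ltrDl ltr01 orbT.
have a0 : 0 < t - c by rewrite subr_gt0.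
apply: (@integrable_affineN R (t - c) c a0).
- exact: measurable_itv.
- by apply/measurable_EFinP; exact: measurable_kernel.
rewrite (affine_preimage_itv _ a0) subrr mul0r divff ?gt_eqF//.
have : leb.-integrable `[0, 1] (fun v =>
    ((t - c) `^ (b - 1))%:E * ((1 - v) `^ (b - 1))%R%:E)%E.
  by apply: integrableZl; [exact: measurable_itv|exact: integrable_kernel01].
apply: eq_integrable; first exact: measurable_itv.
move=> v /set_mem /=; rewrite in_itv/= => /andP[v0 v1].
rewrite -EFinM -powRM ?subr_ge0//; last exact: ltW.
by congr ((_ `^ _)%:E); ring.
Qed.

Lemma integrable_kernelM (f : R -> R) (C c t : R) :
  continuous f -> (forall s, `|f s| <= C) ->
  leb.-integrable `[c, t] (EFin \o (fun s => (t - s) `^ (b - 1) * f s)).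
Proof.
move=> cf fC.
have : leb.-integrable `[c, t] (fun s => C%:E * ((t - s) `^ (b - 1))%R%:E)%E.
  by apply: integrableZl; [exact: measurable_itv|exact: integrable_kernel].
apply: le_integrable; first exact: measurable_itv.
- apply/measurable_EFinP/measurable_funM; first exact: measurable_kernel.
  by apply: measurable_funTS; exact: continuous_measurable_fun.
- move=> s _; rewrite /= lee_fin !normrM mulrC ler_wpM2r//.
  by rewrite (le_trans (fC _))// ler_norm.
Qed.

(** * Fractional integrals of bounded continuous functions *)

Variables (f : R -> R) (C : R).
Hypotheses (cf : continuous f) (fC : forall s, `|f s| <= C).

Let continuous_affine_comp (a d : R) : continuous (fun v => f (a * v + d)).
Proof.
move=> v; apply: (@continuous_comp _ _ _ (fun v => a * v + d) f); last exact: cf.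
by apply: cvgD; [apply: cvgM; [exact: cvg_cst|exact: cvg_id]|exact: cvg_cst].
Qed.

(** The substitution [s := (t - c) v + c] moves the dependence on [t] from the
    domain and the singular kernel to a power of [t - c] and the argument of
    [f]. *)
Lemma kernel_integral_unit (c t : R) : c <= t ->
  \int[leb]_(s in `[c, t]) ((t - s) `^ (b - 1) * f s) =
  (t - c) `^ b *
    \int[leb]_(v in `[0, 1]) ((1 - v) `^ (b - 1) * f ((t - c) * v + c)).
Proof.
rewrite le_eqVlt => /predU1P[->|ct].
  by rewrite set_itv1 Rintegral_set1 subrr powR0 ?gt_eqF// mul0r.
have a0 : 0 < t - c by rewrite subr_gt0.
rewrite (Rintegral_affine c a0 (measurable_itv _) (integrable_kernelM c t cf fC)).
rewrite (affine_preimage_itv _ a0) subrr mul0r divff; last by rewrite gt_eqF.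
rewrite -(mulr_powRB1 (ltW a0) b0) -mulrA; congr (_ * _).
rewrite -RintegralZl//.
  apply: eq_Rintegral => v /set_mem /=; rewrite in_itv/= => /andP[v0 v1].
  rewrite mulrA -powRM ?subr_ge0//; last exact: ltW.
  by congr ((_ `^ _) * _); ring.
by apply: (integrable_kernelM (C := C)) => // w; exact: fC.
Qed.

Lemma kernel_integral_unit_continuous (c : R) :
  continuous (fun t => \int[leb]_(v in `[0, 1])
    ((1 - v) `^ (b - 1) * f ((t - c) * v + c))).
Proof.
move=> t.
have tI : t \in `]t - 1, t + 1[%classic.
  by rewrite inE/= in_itv/= ltrDl ltrBlDr ltrDl ltr01.
have := @continuity_under_integral R _ _ leb
  (fun t v => (1 - v) `^ (b - 1) * f ((t - c) * v + c)) `[0, 1]%classic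
  (measurable_itv _) (t - 1) (t + 1) _ _
  (fun v => C * (1 - v) `^ (b - 1)) _ _ t tI.
apply.
- move=> u _; apply: (integrable_kernelM (C := C)) => // w; exact: fC.
- apply: aeW => v _ u _; apply: cvgM; first exact: cvg_cst.
  apply: (@continuous_comp _ _ _ (fun u => (u - c) * v + c) f); last exact: cf.
  apply: cvgD; last exact: cvg_cst.
  by apply: cvgM; [apply: cvgB; [exact: cvg_id|exact: cvg_cst]|exact: cvg_cst].
- have : leb.-integrable `[0, 1]
      (fun v => C%:E * ((1 - v) `^ (b - 1))%R%:E)%E.
    by apply: integrableZl; [exact: measurable_itv|exact: integrable_kernel].
  by [].
- move=> u _; apply: aeW => v _; rewrite normrM mulrC.
  by rewrite (ger0_norm (powR_ge0 _ _)) ler_wpM2r// powR_ge0.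
Qed.

Lemma kernel_integral_continuous (c e : R) : {within `[c, e], continuous
  (fun t => \int[leb]_(s in `[c, t]) ((t - s) `^ (b - 1) * f s))}.
Proof.
apply: (@continuous_within_eq _ _ _ (fun t => `|t - c| `^ b *
  \int[leb]_(v in `[0, 1]) ((1 - v) `^ (b - 1) * f ((t - c) * v + c)))).
  move=> t /=; rewrite in_itv/= => /andP[ct _].
  by rewrite kernel_integral_unit// ger0_norm// subr_ge0.
move=> t; apply: cvgM; last exact: kernel_integral_unit_continuous.
apply: (@continuous_comp _ _ _ (fun t => t - c) (fun u => `|u| `^ b)).
  by apply: cvgB; [exact: cvg_id|exact: cvg_cst].
exact: continuous_powR_norm.
Qed.

(** The integral up to the image [a t + d] of [t] is split at the image of the
    lower terminal; the second piece is pulled back to [c, t], where the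
    kernel contributes [a `^ (b - 1)] and the substitution a factor [a]. *)
Lemma kernel_integral_affine (a d c t : R) :
  0 < a -> c <= t -> c <= a * c + d ->
  \int[leb]_(s in `[c, a * t + d]) ((a * t + d - s) `^ (b - 1) * f s) =
  \int[leb]_(s in `[c, a * c + d]) ((a * t + d - s) `^ (b - 1) * f s) +
  a `^ b * \int[leb]_(s in `[c, t]) ((t - s) `^ (b - 1) * f (a * s + d)).
Proof.
move=> a0 ct cac.
have act : a * c + d <= a * t + d by rewrite lerD2r ler_pM2l.
rewrite -(mulr_powRB1 (ltW a0) b0) -mulrA.
have -> : a `^ (b - 1) *
    \int[leb]_(s in `[c, t]) ((t - s) `^ (b - 1) * f (a * s + d)) =
  \int[leb]_(s in `[c, t])
    ((a * t + d - (a * s + d)) `^ (b - 1) * f (a * s + d)).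
  rewrite -RintegralZl//; last first.
    by apply: (integrable_kernelM (C := C)) => // w; exact: fC.
  apply: eq_Rintegral => s /set_mem /=; rewrite in_itv/= => /andP[cs st].
  rewrite mulrA -powRM ?subr_ge0//; last exact: ltW.
  by congr ((_ `^ _) * _); ring.
have <- : (fun v => a * v + d) @^-1` `[a * c + d, a * t + d]%classic =
    `[c, t]%classic.
  by rewrite (affine_preimage_itv _ a0) !addrK ![a * _]mulrC !mulfK// gt_eqF.
rewrite -(Rintegral_affine d a0 (measurable_itv _)
  (integrable_kernelM (a * c + d) (a * t + d) cf fC)).
rewrite -(Rintegral_itv_obnd_cbnd (r := a * c + d)); last first.
  apply: integrableS (integrable_kernelM (a * c + d) (a * t + d) cf fC).
  - exact: measurable_itv.
  - exact: measurable_itv.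
  - exact: subset_itv_oc_cc.
rewrite -(@Rintegral_itvB _ _ (BLeft c) (BRight (a * t + d)) (a * c + d)).
- by rewrite [RHS]addrC subrK.
- exact: integrable_kernelM cf fC.
- by rewrite bnd_simp.
- by rewrite bnd_simp.
Qed.
End Kernel.

(** * Contraction ratios *)

Lemma geometric_lt (R : realType) (C r e : R) : 0 <= r < 1 -> 0 < e ->
  exists n, C * r ^+ n < e.
Proof.
move=> /andP[r0 r1] e0.
have : geometric C r @ \oo --> (0 : R) by apply: cvg_geometric; rewrite ger0_norm.
move=> /cvgrPdist_lt /(_ _ e0) [n _ /(_ n (leqnn n))] /=.
rewrite sub0r normrN => ne.
by exists n; rewrite (le_lt_trans _ ne)// ler_norm.
Qed.

Lemma le0_geometric (R : realType) (C r u : R) : 0 <= r < 1 ->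
  (forall n, u <= C * r ^+ n) -> u <= 0.
Proof.
move=> r01 uC; rewrite leNgt; apply/negP => u0.
by have [n] := geometric_lt C r01 u0; rewrite ltNge uC.
Qed.

Lemma common_contraction_ratio (R : realType) (N : nat) (g : nat -> R) :
  (forall k, map_index N k -> `|g k| < 1) ->
  exists2 r, 0 <= r < 1 & forall k, map_index N k -> `|g k| <= r.
Proof.
elim: N => [_|N IH g1].
  by exists 0; [rewrite lexx ltr01|by move=> k /andP[]].
have [k /andP[k1 kN]|r /andP[r0 r1] hr] := IH.
  by apply: g1; rewrite /map_index/= k1/= ltnW.
have [N1|N0] := ltnP 0 N; last first.
  exists r; first by rewrite r0.
  move=> k /= /andP[k1]; rewrite ltnS => kN.
  by have := leq_trans k1 (leq_trans kN N0).
have hN : map_index N.+1 N by apply/andP.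
exists (Num.max r `|g N|).
  by rewrite le_max r0/= gt_max r1 (g1 _ hN).
move=> k /= /andP[k1]; rewrite ltnS leq_eqVlt => /predU1P[->|kN].
  by rewrite le_max lexx orbT.
by rewrite le_max hr//; apply/andP.
Qed.

(** * Probability measures on the line and Borel maps *)

Section MeasureOfCDF.
Variables (R : realType) (F : R -> R) (c e : R).
Hypotheses (Fnd : {homo F : s t / s <= t}) (Frc : right_continuous F).
Hypotheses (F0 : forall t, t < c -> F t = 0) (F1 : forall t, e <= t -> F t = 1).

Let FNy : F @ -oo --> (0 : R).
Proof.
by apply: cvg_near_cst; exists c; split => [|t tc]; [exact: num_real|exact: F0].
Qed.

Let Fy : F @ +oo --> (1 : R).
Proof.
apply: cvg_near_cst; exists e; split => [|t et]; first exact: num_real.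
by apply: F1; exact: ltW.
Qed.

Let cumF : cumulativeBounded (0 : R) (1 : R) :=
  HB.pack F (isCumulative.Build R _ R F Fnd Frc)
    (isCumulativeBounded.Build R 0 1 F FNy Fy).

Lemma probability_of_cdf : exists m : probability (measurableTypeR R) R,
  forall t, m `]-oo, t]%classic = (F t)%:E.
Proof.
exists (lebesgue_stieltjes_measure cumF) => t.
exact: (cdf_lebesgue_stieltjes_id cumF t).
Qed.
End MeasureOfCDF.

Lemma probability_cdf_unique (R : realType)
    (m1 : probability (measurableTypeR R) R)
    (m2 : {measure set (measurableTypeR R) -> \bar R}) :
  (forall t, m1 `]-oo, t]%classic = m2 `]-oo, t]%classic) ->
  forall A : set (measurableTypeR R), measurable A -> m1 A = m2 A.
Proof.
move=> m12 A mA.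
have h := @measure_unique _ R (measurableTypeR R) (@ocitv R)
  (fun n => `]- n%:R, n%:R]%classic) erefl (@ocitvI R) _ _ m1 m2 _ _ A mA.
apply: h.
- by move=> n; exact: is_ocitv.
- apply/seteqP; split => // t _.
  exists (Num.truncn `|t|).+1 => //=.
  have : `|t| < (Num.truncn `|t|).+1%:R by rewrite truncnS_gt.
  by rewrite in_itv/= ltr_norml => /andP[-> /ltW].
- move=> _ [[a b] _ <-] /=.
  have [ab|ab] := leP a b; last first.
    by rewrite set_itv_ge ?measure0// bnd_simp -leNgt ltW.
  have -> : `]a, b]%classic = `]-oo, b]%classic `\` `]-oo, a]%classic.
    by rewrite -[RHS]setCK setCD setCitvl setUC -[LHS]setCK setCitv.
  have sub : (`]-oo, a]%classic : set R) `<=` (`]-oo, b]%classic : set R).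
    by apply: subset_itvl; rewrite bnd_simp.
  have m1oo : (m1 `]-oo, b]%classic < +oo)%E.
    by rewrite -ge0_fin_numE// fin_num_measure.
  have m2oo : (m2 `]-oo, b]%classic < +oo)%E by rewrite -m12.
  rewrite !measureD ?setIidr//.
  by rewrite -[LHS]/(m1 _ - m1 _)%E -[RHS]/(m2 _ - m2 _)%E !m12.
- by move=> n; rewrite -ge0_fin_numE// fin_num_measure//; exact: measurable_itv.
Qed.

Lemma null_setC_eq d (T : measurableType d) (R : realType)
    (nu : {measure set T -> \bar R}) (G U V : set T) :
  measurable G -> measurable U -> measurable V -> nu (~` G) = 0%E ->
  U `&` G = V `&` G -> nu U = nu V.
Proof.
move=> mG mU mV nuG UV.
have restr A : measurable A -> nu A = nu (A `&` G).
  move=> mA; rewrite (measureDI nu mA mG) [X in (X + _)%E](_ : _ = 0%E) ?add0e//.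
  apply: (@subset_measure0 _ _ _ nu _ (~` G)) => //.
  - exact: measurableD.
  - exact: measurableC.
by rewrite (restr U)// (restr V)// UV.
Qed.

Lemma continuous_measurable_borel (R : realType) (M : nat)
    (f : R -> R * 'rV[R]_M) : continuous f ->
  measurable_fun [set: measurableTypeR R]
    (f : measurableTypeR R -> borel_space R M).
Proof.
move=> cf; apply: (@measurability _ _ (measurableTypeR R) (borel_space R M) _ _
  (@open (R * 'rV[R]_M)%type) erefl) => _ [U oU <-].
by rewrite setTI; apply: open_measurable; move/continuousP : cf; apply.
Qed.

Lemma measurable_fst_borel (R : realType) (M : nat) :
  measurable_fun [set: borel_space R M]
    (fst : borel_space R M -> measurableTypeR R).
Proof.
apply: (@measurability _ _ (borel_space R M) (measurableTypeR R) _ _ _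
  (RGenOInfty.measurableE R)) => _ [_ [t ->] <-].
rewrite setTI; apply: sub_sigma_algebra.
have cfst : continuous (fst : R * 'rV[R]_M -> R) by move=> u; exact: cvg_fst.
by move/continuousP : cfst; apply; exact: interval_open.
Qed.

Lemma closed_measurable_borel (R : realType) (M : nat)
    (C : set (R * 'rV[R]_M)) : closed C -> measurable (C : set (borel_space R M)).
Proof.
move=> cC; rewrite -[C]setCK; apply: measurableC; apply: sub_sigma_algebra.
exact: closed_openC.
Qed.

(** * The cells of the interpolation interval *)

Section Cells.
Variables (R : realType) (N : nat) (N3 : (3 <= N)%N) (x a d : nat -> R).
Hypothesis x_incr : forall i, (1 <= i < N)%N -> x i < x i.+1.
Hypothesis P_left : forall k, map_index N k -> affine_map a d k (x 1%N) = x k.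
Hypothesis P_right : forall k, map_index N k -> affine_map a d k (x N) = x k.+1.
Local Notation J := (interpolation_interval N x).
Local Notation P := (affine_map a d).
Local Notation cl := (clamp (x 1%N) (x N)).

Lemma nodes_le i j : (1 <= i)%N -> (i <= j)%N -> (j <= N)%N -> x i <= x j.
Proof.
move=> i1; elim: j => [|j IH]; first by rewrite leqn0 => /eqP ->.
rewrite leq_eqVlt => /predU1P[->//|]; rewrite ltnS => ij jN.
rewrite (le_trans (IH ij (ltnW jN)))// ltW// x_incr// jN andbT.
exact: leq_trans i1 ij.
Qed.

Lemma nodes_lt i j : (1 <= i)%N -> (i < j)%N -> (j <= N)%N -> x i < x j.
Proof.
move=> i1 ij jN; apply: (@lt_le_trans _ _ (x i.+1)).
  by rewrite x_incr// i1/= (leq_trans ij).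
exact: nodes_le.
Qed.

Let N1 : (1 < N)%N. Proof. exact: leq_trans N3. Qed.

Lemma x1_lt_xN : x 1%N < x N. Proof. exact: nodes_lt. Qed.

Let x1N : x 1%N <= x N. Proof. by rewrite ltW// x1_lt_xN. Qed.

Lemma node_interval i : (1 <= i <= N)%N -> J (x i).
Proof.
by move=> /andP[i1 iN]; rewrite /interpolation_interval/= in_itv/= !nodes_le.
Qed.

Lemma affine_slope k : map_index N k -> a k * (x N - x 1%N) = x k.+1 - x k.
Proof. by move=> hk; rewrite -(P_left hk) -(P_right hk) /affine_map; ring. Qed.

Lemma affine_slope_gt0 k : map_index N k -> 0 < a k.
Proof.
move=> hk; have e := affine_slope hk.
have : 0 < a k * (x N - x 1%N) by rewrite e subr_gt0 x_incr.
by rewrite pmulr_lgt0// subr_gt0 x1_lt_xN.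
Qed.

Lemma affine_slope_lt1 k : map_index N k -> a k < 1.
Proof.
move=> hk; have e := affine_slope hk; have /andP[k1 kN] := hk.
have xx : 0 < x N - x 1%N by rewrite subr_gt0 x1_lt_xN.
rewrite -(ltr_pM2r xx) e mul1r.
have [k2|k2] := ltnP 1 k.
  have := nodes_lt (leqnn 1) k2 (ltnW kN).
  by have := @nodes_le k.+1 N isT kN (leqnn N); lra.
(* The first cell is a proper subinterval because there are at least two. *)
have -> : k = 1%N by apply/eqP; rewrite eqn_leq k2.
by rewrite ltrD2r; exact: nodes_lt.
Qed.

Lemma ler_affine k s t : map_index N k -> (P k s <= P k t) = (s <= t).
Proof. by move=> hk; rewrite /affine_map lerD2r ler_pM2l// affine_slope_gt0. Qed.

Lemma ltr_affine k s t : map_index N k -> (P k s < P k t) = (s < t).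
Proof. by move=> hk; rewrite /affine_map ltrD2r ltr_pM2l// affine_slope_gt0. Qed.

Lemma affine_interval k t : map_index N k -> J t -> J (P k t).
Proof.
move=> hk; rewrite /interpolation_interval/= !in_itv/= => /andP[t1 tN].
have /andP[k1 kN] := hk.
have xk : x 1%N <= x k by apply: nodes_le => //; exact: ltnW.
have xk1 : x k.+1 <= x N by apply: nodes_le.
rewrite (le_trans xk)/=; first by rewrite (le_trans _ xk1)// -(P_right hk) ler_affine.
by rewrite -(P_left hk) ler_affine.
Qed.

Lemma cell_cover t : x 1%N <= t < x N ->
  exists k s, [/\ map_index N k, x 1%N <= s < x N & t = P k s].
Proof.
move=> /andP[t1 tN].
have [k /andP[hk /andP[tk tk1]]] :
    exists k, (1 <= k < N)%N && (x k <= t < x k.+1).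
  have : t < x N.-1.+1 by rewrite prednK// ltnW.
  have : (N.-1 < N)%N by rewrite prednK// ltnW.
  elim: N.-1 => [_|n IH nN tn]; first by rewrite ltNge t1.
  have [tn'|tn'] := ltP t (x n.+1); first exact: IH (ltnW nN) tn'.
  by exists n.+1; rewrite nN tn' tn.
have hk' : map_index N k by [].
exists k, ((t - d k) / a k).
have a0 : a k != 0 by rewrite gt_eqF// affine_slope_gt0.
have tE : t = P k ((t - d k) / a k) by rewrite /affine_map; field.
split => //.
by rewrite -(@ler_affine k)// -(@ltr_affine k)// -tE P_left// P_right// tk.
Qed.

Lemma interval_cover t : J t ->
  exists k s, [/\ map_index N k, J s & t = P k s].
Proof.
rewrite /interpolation_interval/= in_itv/= => /andP[t1].
have NK : N.-1.+1 = N by rewrite prednK// ltnW.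
rewrite le_eqVlt => /predU1P[->|tN].
  exists N.-1, (x N); have hk : map_index N N.-1.
    by rewrite /map_index/= NK leqnn andbT -ltnS NK.
  split => //; first by rewrite in_itv/= lexx ltW// x1_lt_xN.
  by rewrite P_right// NK.
have [|k [s [hk /andP[s1 sN] ->]]] := @cell_cover t; first by rewrite t1.
by exists k, s; split => //; rewrite in_itv/= s1 ltW.
Qed.

(** * The attractor *)

Section Attractor.
Variable M : nat.

(** The parametrization of the graph of [g] over the interval, extended to the
    whole line by clamping. *)
Definition graph_point (g : R -> 'rV[R]_M) (t : R) : R * 'rV[R]_M :=
  (cl t, g (cl t)).

Lemma graph_point_in g t : graph_on J g (graph_point g t).
Proof. by split => //; exact: clamp_itv. Qed.

Lemma graph_point_id g t : J t -> graph_point g t = (t, g t).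
Proof. by move=> Jt; rewrite /graph_point clamp_id. Qed.

Variables (g : R -> 'rV[R]_M) (cg : {within J, continuous g}).

Lemma continuous_graph_point : continuous (graph_point g).
Proof.
move=> t.
apply: (@cvg_pair R R 'rV[R]_M (nbhs t) (nbhs (cl t)) (nbhs (g (cl t)))
  _ _ _ cl (g \o cl)); first exact: continuous_clamp.
exact: (continuous_clamp_comp x1N cg).
Qed.

Lemma graph_on_image : graph_on J g = graph_point g @` J.
Proof.
apply/seteqP; split=> [[t z] [/= Jt ->]|_ [t Jt <-]]; last exact: graph_point_in.
by exists t => //; rewrite graph_point_id.
Qed.

Lemma compact_graph : compact (graph_on J g).
Proof.
rewrite graph_on_image.
apply: (@continuous_compact _ _ (graph_point g) J); last exact: segment_compact.
by apply: continuous_subspaceT; exact: continuous_graph_point.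
Qed.

Variables (gamma : nat -> R) (Q : nat -> R -> 'rV[R]_M).
Hypothesis gamma1 : forall k, map_index N k -> `|gamma k| < 1.
Hypothesis g_eq : forall k t, map_index N k -> J t ->
  g (P k t) = gamma k *: g t + Q k t.
Local Notation W := (ifs_map a d gamma Q).

Lemma ifs_map_graph k t : map_index N k -> J t ->
  W k (t, g t) = (P k t, g (P k t)).
Proof. by move=> hk Jt; rewrite /ifs_map/= g_eq. Qed.

Lemma graph_is_attractor : is_attractor N (ifs_space N x) W (graph_on J g).
Proof.
split.
- by move=> u [Ju _].
- by exists (graph_point g (x 1%N)); exact: graph_point_in.
- exact: compact_graph.
apply/seteqP; split=> [[t z] [/= Jt ->]|_ [k hk] [[t z] [/= Jt ->] <-]].
  have [k [s [hk Js tE]]] := interval_cover Jt.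
  by exists k => //; exists (s, g s) => //; rewrite tE ifs_map_graph.
by rewrite ifs_map_graph//; split => //=; exact: affine_interval.
Qed.

Section Uniqueness.
Variable B : set (R * 'rV[R]_M).
Hypothesis hB : is_attractor N (ifs_space N x) W B.

Let BJ u : B u -> J u.1.
Proof. by case: hB => BX _ _ _ /BX[]. Qed.

Let BE u : B u -> exists k v, [/\ map_index N k, B v & u = W k v].
Proof.
have [_ _ _ {1}->] := hB => -[k hk [v Bv <-]].
by exists k, v.
Qed.

(** In each coordinate the vertical distance to the graph, bounded on the compact
    set [B], is multiplied by [`|gamma k|] under the [k]-th map; as every point of
    [B] has preimages of all orders in [B], it vanishes. *)
Lemma attractor_sub_graph : B `<=` graph_on J g.
Proof.
move=> u Bu; split; first exact: BJ.
have [r r01 hr] := common_contraction_ratio gamma1.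
have [_ B0 cB _] := hB.
apply/rowP => i; apply/eqP; rewrite -subr_eq0 -normr_le0.
pose dev (u : R * 'rV[R]_M) := `|u.2 ord0 i - g (cl u.1) ord0 i|.
have cdev : continuous dev.
  move=> v; apply: (@continuous_comp _ _ _ (fun u : R * 'rV[R]_M =>
    u.2 ord0 i - g (cl u.1) ord0 i) Num.norm); last exact: norm_continuous.
  apply: cvgB.
    apply: (@continuous_comp _ _ _ snd (fun z : 'rV[R]_M => z ord0 i)).
      exact: cvg_snd.
    exact: coord_continuous.
  apply: (@continuous_comp _ _ _ (fun u : R * 'rV[R]_M => g (cl u.1))
    (fun z : 'rV[R]_M => z ord0 i)); last exact: coord_continuous.
  apply: (@continuous_comp _ _ _ fst (g \o cl)); first exact: cvg_fst.
  exact: (continuous_clamp_comp x1N cg).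
have [m _ hm] := compact_EVT_max B0 cB (continuous_subspaceT cdev).
have dev_le n v : B v -> `|v.2 ord0 i - g v.1 ord0 i| <= dev m * r ^+ n.
  elim: n v => [|n IH] v Bv.
    rewrite expr0 mulr1 (le_trans _ (hm v _)) ?inE// /dev clamp_id//.
    exact: BJ.
  have [k [w [hk Bw ->]]] := BE Bv.
  rewrite /= g_eq//; last exact: BJ.
  rewrite !mxE opprD addrACA subrr addr0 -mulrBr normrM exprS mulrCA.
  by rewrite ler_pM// ?hr// IH.
by apply: (@le0_geometric R (dev m) r) => // n; exact: dev_le.
Qed.

Lemma attractor_proj_dense t (e : R) : J t -> 0 < e ->
  exists2 u, B u & `|t - u.1| < e.
Proof.
move=> Jt e0.
have a1 k : map_index N k -> `|a k| < 1.
  by move=> hk; rewrite gtr0_norm ?affine_slope_gt0// affine_slope_lt1.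
have [r r01 hr] := common_contraction_ratio a1.
have [_ [b Bb] _ _] := hB.
have dense n s : J s ->
    exists2 u, B u & `|s - u.1| <= (x N - x 1%N) * r ^+ n.
  elim: n s => [|n IH] s Js.
    exists b => //; have := BJ Bb; move: Js.
    rewrite /interpolation_interval/= !in_itv/= => /andP[s1 sN] /andP[b1 bN].
    by rewrite expr0 mulr1 ler_norml; apply/andP; split; lra.
  have [k [s' [hk Js' ->]]] := interval_cover Js.
  have [u Bu us] := IH _ Js'.
  exists (W k u).
    by have [_ _ _ ->] := hB; exists k => //; exists u.
  rewrite /= /affine_map opprD addrACA subrr addr0 -mulrBr normrM exprS mulrCA.
  by rewrite ler_pM// ?hr.
have [n ne] := geometric_lt (x N - x 1%N) r01 e0.
have [u Bu us] := dense n _ Jt.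
by exists u => //; exact: le_lt_trans us ne.
Qed.

Lemma attractor_unique : B = graph_on J g.
Proof.
apply/seteqP; split; first exact: attractor_sub_graph.
move=> [t z] [/= Jt ->].
have [_ _ cB _] := hB.
have clB : closed (fst @` B).
  apply: compact_closed; first exact: Rhausdorff.
  apply: continuous_compact cB; apply: continuous_subspaceT => u.
  exact: cvg_fst.
have : (fst @` B) t.
  apply: clB => V /nbhs_ballP[e /= e0 eV].
  have [u Bu ut] := attractor_proj_dense Jt e0.
  by exists u.1; split; [exists u|exact: eV].
move=> [[t' z'] Bu /= tE]; have [/= _ zE] := attractor_sub_graph Bu.
by rewrite -tE -zE.
Qed.
End Uniqueness.

Lemma graph_is_unique_attractor :
  is_unique_attractor N (ifs_space N x) W (graph_on J g).
Proof. by split; [exact: graph_is_attractor|exact: attractor_unique]. Qed.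

End Attractor.

(** * The fractional integral of the interpolation function *)

Section FractionalIntegral.
Variables (M : nat) (beta : R) (beta0 : 0 < beta).
Local Notation leb := (@lebesgue_measure R).
Variables (h : R -> 'rV[R]_M) (ch : {within J, continuous h}).

Lemma continuous_coord_clamp (f : R -> 'rV[R]_M) (i : 'I_M) :
  {within J, continuous f} -> continuous (fun s => f (cl s) ord0 i).
Proof.
move=> cf s.
apply: (@continuous_comp _ _ _ (f \o cl) (fun z : 'rV[R]_M => z ord0 i)).
  exact: (continuous_clamp_comp x1N cf).
exact: coord_continuous.
Qed.

Lemma bounded_coord_clamp (f : R -> 'rV[R]_M) (i : 'I_M) :
  {within J, continuous f} -> exists C, forall s, `|f (cl s) ord0 i| <= C.
Proof.
move=> cf; apply: (@within_continuous_bounded R _ _ x1N (fun s => f s ord0 i)).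
apply: (@within_continuous_comp 'rV[R]_M R R J f (fun z => z ord0 i)) => //.
by move=> z _; exact: coord_continuous.
Qed.

Lemma kernel_integral_clamp (f : R -> 'rV[R]_M) (i : 'I_M) (t u : R) : J t ->
  \int[leb]_(s in `[x 1%N, t]) ((u - s) `^ (beta - 1) * f s ord0 i) =
  \int[leb]_(s in `[x 1%N, t]) ((u - s) `^ (beta - 1) * f (cl s) ord0 i).
Proof.
rewrite /interpolation_interval/= in_itv/= => /andP[t1 tN].
apply: eq_Rintegral => s /set_mem/=; rewrite in_itv/= => /andP[s1 st].
by rewrite clamp_id//= in_itv/= s1 (le_trans st).
Qed.

Lemma RL_integral_continuous :
  {within J, continuous (RL_integral (x 1%N) beta h)}.
Proof.
apply: continuous_rV => i.
have [C hC] := bounded_coord_clamp i ch.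
have cint := @kernel_integral_continuous _ _ beta0 _ _
  (@continuous_coord_clamp h i ch) hC (x 1%N) (x N).
apply: (@subspace_eq_continuous _ J _ (from_subspace J (fun t : R =>
  (Gamma beta)^-1 * \int[leb]_(s in `[x 1%N, t])
    ((t - s) `^ (beta - 1) * h (cl s) ord0 i)))).
  move=> t /set_mem Jt; rewrite /from_subspace /RL_integral mxE; congr (_ * _).
  exact/esym/(@kernel_integral_clamp h i t _ Jt).
by move=> t; apply: cvgM; [exact: cvg_cst|exact: cint].
Qed.

Variables (alpha : nat -> R) (q : nat -> R -> 'rV[R]_M).
Hypothesis cq : forall k, map_index N k -> {within J, continuous (q k)}.
Hypothesis h_eq : forall k t, map_index N k -> J t ->
  h (P k t) = alpha k *: h t + q k t.

Lemma RL_integral_eq k t : map_index N k -> J t ->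
  RL_integral (x 1%N) beta h (P k t) =
  (a k `^ beta * alpha k) *: RL_integral (x 1%N) beta h t +
  RL_parameter x a d beta q h k t.
Proof.
move=> hk Jt; apply/rowP => i; rewrite !mxE.
have x1J : J (x 1%N) by rewrite /interpolation_interval/= in_itv/= lexx x1N.
have JP s : J s -> J (P k s) by exact: affine_interval.
have [C hC] := bounded_coord_clamp i ch.
have [D hD] := bounded_coord_clamp i (cq hk).
have ch' := @continuous_coord_clamp h i ch.
have cq' := @continuous_coord_clamp (q k) i (cq hk).
rewrite (@kernel_integral_clamp h i _ (P k t) (JP _ Jt)).
rewrite (@kernel_integral_clamp h i t _ Jt).
rewrite (@kernel_integral_clamp h i _ _ (JP _ x1J)).
rewrite (@kernel_integral_clamp (q k) i t _ Jt).
have t1 : x 1%N <= t.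
  by move: Jt; rewrite /interpolation_interval/= in_itv/= => /andP[].
have xP : x 1%N <= P k (x 1%N).
  by have := JP _ x1J; rewrite /interpolation_interval/= in_itv/= => /andP[].
rewrite {1 2}/affine_map.
rewrite (kernel_integral_affine beta0 ch' hC (affine_slope_gt0 hk) t1 xP).
set I2 := \int[leb]_(s in _) (_ * h (cl (a k * s + d k)) ord0 i).
have -> : I2 = alpha k * \int[leb]_(s in `[x 1%N, t])
      ((t - s) `^ (beta - 1) * h (cl s) ord0 i)
   + \int[leb]_(s in `[x 1%N, t])
      ((t - s) `^ (beta - 1) * q k (cl s) ord0 i).
  rewrite -RintegralZl; last 2 first.
  - exact: measurable_itv.
  - exact: (integrable_kernelM beta0 _ _ ch' hC).
  rewrite -RintegralD; last 3 first.
  - exact: measurable_itv.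
  - have : leb.-integrable `[x 1%N, t] (fun s => (alpha k)%:E *
        ((t - s) `^ (beta - 1) * h (cl s) ord0 i)%R%:E)%E.
      apply: integrableZl; first exact: measurable_itv.
      exact: (integrable_kernelM beta0 _ _ ch' hC).
    by [].
  - exact: (integrable_kernelM beta0 _ _ cq' hD).
  apply: eq_Rintegral => s /set_mem/=; rewrite in_itv/= => /andP[s1 st].
  have Js : J s.
    move: Jt; rewrite /interpolation_interval/= !in_itv/= s1 => /andP[_].
    exact: le_trans.
  have -> : cl (a k * s + d k) = P k s by rewrite clamp_id//; exact: JP.
  by rewrite h_eq// clamp_id// !mxE; ring.
rewrite /affine_map.
set A := Rintegral _ _ _; set B := Rintegral _ _ _; set E := Rintegral _ _ _.
by move: A B E => A B E; ring.
Qed.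

Lemma RL_scale_lt1 k : map_index N k -> -1 < alpha k < 1 ->
  `|a k `^ beta * alpha k| < 1.
Proof.
move=> hk; rewrite -ltr_norml => hal.
rewrite normrM ger0_norm ?powR_ge0//.
have ab : a k `^ beta <= 1.
  have -> : 1 = 1 `^ beta :> R by rewrite powR1.
  apply: ge0_ler_powR; rewrite ?nnegrE//; first exact: ltW.
  - by rewrite ltW// affine_slope_gt0.
  - by rewrite ltW// affine_slope_lt1.
by rewrite (le_lt_trans _ hal)// ler_piMl.
Qed.

(** On the interval the parameter is the difference between the two other terms
    of the functional equation. *)
Lemma RL_parameter_continuous k : map_index N k ->
  {within J, continuous (RL_parameter x a d beta q h k)}.
Proof.
move=> hk.
have cI := RL_integral_continuous.
have cIP : {within J, continuous (RL_integral (x 1%N) beta h \o P k)}.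
  apply: (@continuous_within_eq _ _ _
    ((RL_integral (x 1%N) beta h \o cl) \o P k)).
    by move=> t Jt /=; rewrite clamp_id//; exact: affine_interval.
  move=> t; apply: continuous_comp.
    apply: cvgD; last exact: cvg_cst.
    by apply: cvgM; [exact: cvg_cst|exact: cvg_id].
  exact: (continuous_clamp_comp x1N cI).
apply: (@subspace_eq_continuous _ J _ (from_subspace J (fun t : R =>
  RL_integral (x 1%N) beta h (P k t) -
  (a k `^ beta * alpha k) *: RL_integral (x 1%N) beta h t))).
  by move=> t /set_mem Jt; rewrite /from_subspace RL_integral_eq// addrC addKr.
move=> t; apply: cvgB; first exact: cIP.
by apply: cvgZr; exact: cI.
Qed.
End FractionalIntegral.

(** * The self-similar distribution function *)

Section SelfSimilarCDF.
Variables (p : nat -> R) (p_prob : is_probability_vector N p).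

Let p0 k : map_index N k -> 0 < p k. Proof. by case: p_prob => + _; apply. Qed.
Let p1 : \sum_(1 <= k < N) p k = 1. Proof. by case: p_prob. Qed.

(** The inverse of the affine map [P k]. *)
Definition affine_inv k (t : R) := (t - d k) / a k.

Lemma affine_invK k t : map_index N k -> P k (affine_inv k t) = t.
Proof.
move=> hk; rewrite /affine_map /affine_inv; field.
by rewrite gt_eqF// affine_slope_gt0.
Qed.

Lemma affineK k t : map_index N k -> affine_inv k (P k t) = t.
Proof.
move=> hk; rewrite /affine_map /affine_inv; field.
by rewrite gt_eqF// affine_slope_gt0.
Qed.

Lemma affine_inv_le k s t : map_index N k -> (affine_inv k t <= s) = (t <= P k s).
Proof. by move=> hk; rewrite -(@ler_affine k)// affine_invK. Qed.

Lemma affine_inv_lt k s t : map_index N k -> (affine_inv k t < s) = (t < P k s).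
Proof. by move=> hk; rewrite -(@ltr_affine k)// affine_invK. Qed.

Lemma affine_inv_ge k s t : map_index N k -> (s <= affine_inv k t) = (P k s <= t).
Proof. by move=> hk; rewrite -(@ler_affine k)// affine_invK. Qed.

(** The action of the weighted system on distribution functions: if [f] is the
    distribution function of a measure [m], then [transfer f] is that of the sum
    of the images of [m] under the [P k], weighted by the [p k]. *)
Definition transfer (f : R -> R) (t : R) : R :=
  \sum_(1 <= k < N) p k * f (affine_inv k t).

(** The boundary behaviour of the distribution function of a probability measure
    carried by the interpolation interval. *)
Definition cdf_on_interval (f : R -> R) : Prop :=
  (forall t, t < x 1%N -> f t = 0) /\ (forall t, x N <= t -> f t = 1).

Lemma prob_lt1 k : map_index N k -> p k < 1.
Proof.
move=> hk; have /andP[k1 kN] := hk; rewrite -p1.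
have [j hj jk] : exists2 j, map_index N j & j != k.
  have [->|k2] := eqVneq k 1%N; first by exists 2%N.
  by exists 1%N; [rewrite /map_index/= (leq_trans _ N3)|rewrite eq_sym].
rewrite (bigD1_seq k)/=; [|by rewrite mem_index_iota|exact: iota_uniq].
rewrite ltrDl -big_filter (bigD1_seq j)/=; first last.
- by apply: filter_uniq; exact: iota_uniq.
- by rewrite mem_filter jk mem_index_iota.
rewrite ltr_pwDl ?p0// big_seq_cond sumr_ge0// => i.
by rewrite mem_filter mem_index_iota => /andP[/andP[_ hi] _]; rewrite ltW// p0.
Qed.

Lemma prob_ratio : exists2 r, 0 <= r < 1 & forall k, map_index N k -> p k <= r.
Proof.
have [|r r01 hr] := @common_contraction_ratio R N p.
  by move=> k hk; rewrite gtr0_norm ?p0// prob_lt1.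
by exists r => // k hk; rewrite (le_trans _ (hr _ hk))// ler_norm.
Qed.

Lemma transfer_out f : cdf_on_interval f -> cdf_on_interval (transfer f).
Proof.
move=> [f0 f1]; split => t ht.
  rewrite /transfer big_nat big1// => k hk; rewrite f0 ?mulr0//.
  rewrite affine_inv_lt// P_left// (lt_le_trans ht)//.
  by have /andP[k1 kN] := hk; rewrite nodes_le// ltnW.
rewrite /transfer -[RHS]p1 big_nat [RHS]big_nat; apply: eq_bigr => k hk.
rewrite f1 ?mulr1// affine_inv_ge// P_right// (le_trans _ ht)//.
by have /andP[k1 kN] := hk; rewrite nodes_le.
Qed.

(** Inside the [k]-th cell the inverse images under the earlier maps lie to the
    right of the interval, where [f] is 1, and those under the later maps to
    its left, where [f] is 0. *)
Lemma transfer_cell f k s : cdf_on_interval f -> map_index N k ->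
  x 1%N <= s < x N -> transfer f (P k s) = \sum_(1 <= j < k) p j + p k * f s.
Proof.
move=> [f0 f1] hk /andP[s1 sN]; have /andP[k1 kN] := hk.
rewrite /transfer (big_cat_nat k1 (ltnW kN))/=.
congr (_ + _).
  rewrite big_nat [RHS]big_nat; apply: eq_bigr => j /andP[j1 jk].
  have hj : map_index N j by rewrite /map_index/= j1 (ltn_trans jk).
  rewrite f1 ?mulr1// affine_inv_ge// P_right//.
  rewrite (@le_trans _ _ (x k))//; first by rewrite nodes_le// ltnW.
  by rewrite -(P_left hk) ler_affine.
rewrite big_ltn// affineK// big_nat big1 ?addr0// => j /andP[kj jN].
have hj : map_index N j by rewrite /map_index/= jN (leq_trans k1)// ltnW.
rewrite f0 ?mulr0// affine_inv_lt// P_left//.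
rewrite (@lt_le_trans _ _ (x k.+1))//; last by rewrite nodes_le// ltnW.
by rewrite -(P_right hk) ltr_affine.
Qed.

Lemma cdf_uniq f g : cdf_on_interval f -> cdf_on_interval g ->
  (forall t, 0 <= f t <= 1) -> (forall t, 0 <= g t <= 1) ->
  (forall t, f t = transfer f t) -> (forall t, g t = transfer g t) -> f =1 g.
Proof.
move=> zf zg f01 g01 fT gT t; apply/eqP; rewrite -subr_eq0 -normr_le0.
have [r /andP[r0 r1] hr] := prob_ratio.
apply: (@le0_geometric R 1 r); first by rewrite r0.
move=> n; rewrite mul1r; elim: n t => [|n IH] t.
  have /andP[? ?] := f01 t; have /andP[? ?] := g01 t.
  by rewrite expr0 ler_norml; apply/andP; split; lra.
have [t1|t1] := ltP t (x 1%N).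
  by case: zf => -> // _; case: zg => -> // _; rewrite subrr normr0 exprn_ge0.
have [tN|tN] := leP (x N) t.
  by case: zf => _ -> //; case: zg => _ -> //; rewrite subrr normr0 exprn_ge0.
have [|k [s [hk sJ ->]]] := @cell_cover t; first by rewrite t1.
rewrite fT gT !transfer_cell// opprD addrACA subrr add0r -mulrBr normrM exprS.
by rewrite ler_pM// gtr0_norm ?hr// p0.
Qed.

(** The iterates from the distribution function of the point mass at [x N]. *)
Definition cdf_iter (n : nat) : R -> R :=
  iter n transfer (fun t => (x N <= t)%R%:R).

Lemma cdf_iter_out n : cdf_on_interval (cdf_iter n).
Proof.
elim: n => [|n IH]; last exact: transfer_out.
split=> t ht /=; last by rewrite ht.
by rewrite leNgt (lt_trans ht x1_lt_xN).
Qed.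

Lemma transfer_le f g t : (forall s, f s <= g s) -> transfer f t <= transfer g t.
Proof.
move=> fg; rewrite /transfer big_nat [leRHS]big_nat; apply: ler_sum => k hk.
by rewrite ler_wpM2l// ltW// p0.
Qed.

Lemma cdf_iter_ge0 n t : 0 <= cdf_iter n t.
Proof.
elim: n t => [|n IH] t /=; first by rewrite ler0n.
rewrite /transfer big_nat sumr_ge0// => k hk.
by rewrite mulr_ge0// ltW// p0.
Qed.

Lemma cdf_iter_le1 n t : cdf_iter n t <= 1.
Proof.
elim: n t => [|n IH] t /=; first by rewrite lern1 leq_b1.
rewrite -[leRHS]p1 /transfer big_nat [leRHS]big_nat; apply: ler_sum => k hk.
by rewrite -[leRHS]mulr1 ler_wpM2l// ltW// p0.
Qed.

Lemma cdf_iter_homo n : {homo cdf_iter n : s t / s <= t}.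
Proof.
elim: n => [|n IH] s t st /=.
  by rewrite ler_nat; case: (leP (x N) s) => // h; rewrite (le_trans h st).
rewrite /transfer big_nat [leRHS]big_nat; apply: ler_sum => k hk.
rewrite ler_wpM2l//; first by rewrite ltW// p0.
by apply: IH; rewrite affine_inv_le// affine_invK.
Qed.

Lemma cdf_iter_incr t : nondecreasing_seq (cdf_iter ^~ t).
Proof.
apply/nondecreasing_seqP => n; elim: n t => [|n IH] t /=.
  have [tN|tN] := leP (x N) t; last exact: (cdf_iter_ge0 1).
  by have [_ /(_ _ tN)] := cdf_iter_out 1; rewrite /= => ->.
exact: transfer_le.
Qed.

(** The distribution function of the invariant measure of the maps [P k] with
    weights [p k]. *)
Definition selfsimilar_cdf (t : R) : R := limn (cdf_iter ^~ t).
Local Notation F := selfsimilar_cdf.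

Lemma cdf_iter_cvg t : cdf_iter ^~ t @ \oo --> F t.
Proof.
apply: nondecreasing_is_cvgn; first exact: cdf_iter_incr.
by exists 1 => _ [n _ <-]; exact: cdf_iter_le1.
Qed.

Lemma selfsimilar_cdf_out : cdf_on_interval F.
Proof.
split => t ht; apply/cvg_lim => //.
  by under eq_fun do rewrite (proj1 (cdf_iter_out _))//; exact: cvg_cst.
by under eq_fun do rewrite (proj2 (cdf_iter_out _))//; exact: cvg_cst.
Qed.

Lemma selfsimilar_cdf_homo : {homo F : s t / s <= t}.
Proof.
move=> s t st; apply: ler_lim.
- by apply/cvg_ex; eexists; exact: cdf_iter_cvg.
- by apply/cvg_ex; eexists; exact: cdf_iter_cvg.
by apply: nearW => n; exact: cdf_iter_homo.
Qed.

Lemma selfsimilar_cdf01 t : 0 <= F t <= 1.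
Proof.
have [F0 F1] := selfsimilar_cdf_out.
rewrite -(F0 (Num.min t (x 1%N - 1))).
  rewrite -(F1 (Num.max t (x N))); last by rewrite le_max lexx orbT.
  by rewrite !selfsimilar_cdf_homo// ?ge_min ?le_max lexx.
by rewrite gt_min ltrBlDr ltrDl ltr01 orbT.
Qed.

Lemma selfsimilar_cdfE t : F t = transfer F t.
Proof.
have zF := selfsimilar_cdf_out; have zT := transfer_out zF.
have [t1|t1] := ltP t (x 1%N).
  by case: zF => -> // _; case: zT => -> // _.
have [tN|tN] := leP (x N) t.
  by case: zF => _ -> //; case: zT => _ -> //.
have [|k [s [hk sJ ->]]] := @cell_cover t; first by rewrite t1.
rewrite transfer_cell//.
have : cdf_iter n.+1 (P k s) @[n --> \oo] -->
    \sum_(1 <= j < k) p j + p k * F s.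
  rewrite (_ : (fun n => _) =
      fun n => \sum_(1 <= j < k) p j + p k * cdf_iter n s).
    apply: cvgD; first exact: cvg_cst.
    by apply: cvgM; [exact: cvg_cst|exact: cdf_iter_cvg].
  by apply/funext => n; rewrite /= transfer_cell//; exact: cdf_iter_out.
rewrite (cvg_shiftS (cdf_iter ^~ (P k s))) => h.
exact: cvg_unique (@cdf_iter_cvg (P k s)) h.
Qed.

(** Inside a cell an increment of [F] is [p k] times the corresponding increment
    at the preimage, so right increments over small enough steps are at most
    every power of [r]. *)
Lemma selfsimilar_cdf_right_increment (r : R) : 0 <= r ->
  (forall k, map_index N k -> p k <= r) ->
  forall n t, exists2 e, 0 < e & F (t + e) - F t <= r ^+ n.
Proof.
move=> r0 hr; have [F0 F1] := selfsimilar_cdf_out.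
elim=> [|n IH] t.
  exists 1 => //; have /andP[? ?] := selfsimilar_cdf01 t.
  by have /andP[? ?] := selfsimilar_cdf01 (t + 1); rewrite expr0; lra.
have [t1|t1] := ltP t (x 1%N).
  exists ((x 1%N - t) / 2); first by rewrite divr_gt0// subr_gt0.
  by rewrite !F0// ?subrr ?exprn_ge0//; lra.
have [tN|tN] := leP (x N) t.
  by exists 1 => //; rewrite !F1// ?subrr ?exprn_ge0//; lra.
have [|k [s [hk /andP[s1 sN] tE]]] := @cell_cover t; first by rewrite t1.
have [e e0 he] := IH s.
(* The step at the preimage is shortened so as not to leave the interval. *)
pose e' := Num.min e ((x N - s) / 2).
have e'0 : 0 < e' by rewrite lt_min e0 divr_gt0// subr_gt0.
have e'N : e' <= (x N - s) / 2 by rewrite ge_min lexx orbT.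
exists (a k * e'); first by rewrite mulr_gt0// affine_slope_gt0.
have -> : t + a k * e' = P k (s + e') by rewrite tE /affine_map; ring.
rewrite tE (selfsimilar_cdfE (P k s)) (selfsimilar_cdfE (P k (s + e'))).
have zF := selfsimilar_cdf_out.
have h1 : x 1%N <= s < x N by rewrite s1.
have h2 : x 1%N <= s + e' < x N by apply/andP; split; lra.
rewrite !transfer_cell//.
rewrite opprD addrACA subrr add0r -mulrBr exprS.
have se : F (s + e') <= F (s + e).
  by apply: selfsimilar_cdf_homo; rewrite lerD2l ge_min lexx.
apply: ler_pM.
- by rewrite ltW// p0.
- by rewrite subr_ge0 selfsimilar_cdf_homo// lerDl ltW.
- exact: hr.
- by rewrite (le_trans _ he)// lerD2r.
Qed.

Lemma selfsimilar_cdf_right_continuous : right_continuous F.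
Proof.
move=> t; have [r r01 hr] := prob_ratio; have /andP[r0 _] := r01.
apply/cvgrPdist_lt => /= e e0.
have [n] := geometric_lt 1 r01 e0; rewrite mul1r => ne.
have [u u0 hu] := selfsimilar_cdf_right_increment r0 hr n t.
near=> s.
have ts : t <= s by near: s; exact: nbhs_right_ge.
have su : s <= t + u by near: s; apply: nbhs_right_le; rewrite ltrDl.
rewrite distrC ger0_norm ?subr_ge0 ?selfsimilar_cdf_homo//.
by rewrite (le_lt_trans _ ne)// (le_trans _ hu)// lerD2r selfsimilar_cdf_homo.
Unshelve. all: by end_near. Qed.

(** * The invariant measure *)

(** The affine map [P k] on the interval, extended to the line by clamping. *)
Definition clamped_affine k (t : R) : R := P k (cl t).

Lemma measurable_clamped_affine k : measurable_fun [set: measurableTypeR R]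
  (clamped_affine k : measurableTypeR R -> measurableTypeR R).
Proof.
apply: continuous_measurable_fun => t; apply: cvgD; last exact: cvg_cst.
by apply: cvgM; [exact: cvg_cst|exact: continuous_clamp].
Qed.

Lemma clamped_affine_cdf (m : probability (measurableTypeR R) R) k t :
  (forall t, m `]-oo, t]%classic = (F t)%:E) -> map_index N k ->
  m (clamped_affine k @^-1` `]-oo, t]%classic) = (F (affine_inv k t))%:E.
Proof.
move=> mF hk; have [F0 F1] := selfsimilar_cdf_out.
set s := affine_inv k t.
have -> : clamped_affine k @^-1` `]-oo, t]%classic = cl @^-1` `]-oo, s]%classic.
  apply/seteqP; split=> u; rewrite /= !in_itv/=.
    by rewrite /clamped_affine /s affine_inv_ge.
  by rewrite /clamped_affine /s affine_inv_ge.
have [s1|s1] := ltP s (x 1%N).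
  rewrite F0// (_ : _ @^-1` _ = set0) ?measure0//.
  apply/seteqP; split=> u //; rewrite /= in_itv/= => /le_lt_trans /(_ s1).
  have := clamp_itv x1N u; rewrite /= in_itv/= => /andP[h _].
  by rewrite ltNge h.
have [sN|sN] := leP (x N) s.
  rewrite F1// (_ : _ @^-1` _ = setT) ?probability_setT//.
  apply/seteqP; split=> u // _; rewrite /= in_itv/= (le_trans _ sN)//.
  by have := clamp_itv x1N u; rewrite /= in_itv/= => /andP[].
rewrite -mF; congr (m _); apply/seteqP; split=> u; rewrite /= !in_itv/= /clamp.
  by rewrite ge_max s1/= ge_min (leNgt (x N)) sN orbF.
by rewrite ge_max s1/= ge_min => ->.
Qed.

(** Both sides of the invariance equation are measures in [A], with distribution
    functions [F] and [transfer F]. *)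
Lemma selfsimilar_measure : exists m : probability (measurableTypeR R) R,
  (forall t, m `]-oo, t]%classic = (F t)%:E) /\
  (forall A : set (measurableTypeR R), measurable A ->
    m A = (\sum_(1 <= k < N) (p k)%:E * m (clamped_affine k @^-1` A))%E).
Proof.
have [F0 F1] := selfsimilar_cdf_out.
have [m mF] := probability_of_cdf selfsimilar_cdf_homo
  selfsimilar_cdf_right_continuous F0 F1.
exists m; split => // A mA.
pose Y k : {mfun measurableTypeR R >-> measurableTypeR R} :=
  HB.pack (clamped_affine k : measurableTypeR R -> measurableTypeR R)
    (isMeasurableFun.Build _ _ _ _
      (clamped_affine k : measurableTypeR R -> measurableTypeR R)
      (measurable_clamped_affine k)).
(* The absolute value makes the weight nonnegative for every index. *)
pose mk k : {measure set (measurableTypeR R) -> \bar R} :=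
  mscale (NngNum (normr_ge0 (p k.+1))) (distribution m (Y k.+1)).
pose m2 : {measure set (measurableTypeR R) -> \bar R} := msum mk N.-1.
have m2E B :
    m2 B = (\sum_(1 <= k < N) (p k)%:E * m (clamped_affine k @^-1` B))%E.
  rewrite big_add1 big_mkord /m2 /msum; apply: eq_bigr => k _.
  have hk : map_index N k.+1.
    by have := ltn_ord k; rewrite /map_index/= -ltnS prednK// (leq_trans _ N3).
  rewrite -[LHS]/(`|p k.+1|%:E * m (clamped_affine k.+1 @^-1` B))%E gtr0_norm//.
  exact: p0.
rewrite -m2E; apply: probability_cdf_unique mA => t.
rewrite m2E mF selfsimilar_cdfE /transfer -sumEFin big_nat [RHS]big_nat.
by apply: eq_bigr => k hk; rewrite clamped_affine_cdf.
Qed.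

Section GraphMeasure.
Variable M : nat.
Variables (g : R -> 'rV[R]_M) (cg : {within J, continuous g}).
Variables (gamma : nat -> R) (Q : nat -> R -> 'rV[R]_M).
Hypothesis g_eq : forall k t, map_index N k -> J t ->
  g (P k t) = gamma k *: g t + Q k t.
Local Notation W := (ifs_map a d gamma Q).
Local Notation X := (ifs_space N x).
Local Notation G := (graph_on J g).
Local Notation phi := (graph_point g).

Let mphi : measurable_fun [set: measurableTypeR R]
  (phi : measurableTypeR R -> borel_space R M).
Proof. by apply: continuous_measurable_borel; exact: continuous_graph_point. Qed.

Lemma measurable_graph : measurable (G : set (borel_space R M)).
Proof.
apply: closed_measurable_borel; apply: compact_closed; first exact: norm_hausdorff.
exact: compact_graph.
Qed.

(** The parametrization of the graph conjugates the [k]-th map to [P k]. *)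
Lemma graph_point_preimage (B : set (R * 'rV[R]_M)) k : map_index N k ->
  phi @^-1` (X `&` W k @^-1` B) = clamped_affine k @^-1` (phi @^-1` B).
Proof.
move=> hk.
have Jcl t : J (cl t) by exact: clamp_itv.
have JP t : J (clamped_affine k t) by exact: affine_interval.
have WE t : W k (phi t) = phi (clamped_affine k t).
  by rewrite [RHS]graph_point_id// -[phi t]/(cl t, g (cl t)) /ifs_map/= -g_eq.
apply/seteqP; split=> t /=; first by move=> [_]; rewrite WE.
by move=> Bt; split; [split => //; exact: Jcl|rewrite WE].
Qed.

Lemma graph_measure_exists (m : probability (measurableTypeR R) R) :
  (forall A : set (measurableTypeR R), measurable A ->
    m A = (\sum_(1 <= k < N) (p k)%:E * m (clamped_affine k @^-1` A))%E) ->
  exists mu : probability (borel_space R M) R,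
    [/\ supported_on mu G, is_invariant_measure N X W p mu &
      forall B : set (borel_space R M), mu B = m (phi @^-1` B)].
Proof.
move=> mE.
pose Y : {mfun measurableTypeR R >-> borel_space R M} :=
  HB.pack (phi : measurableTypeR R -> borel_space R M)
    (isMeasurableFun.Build _ _ _ _
      (phi : measurableTypeR R -> borel_space R M) mphi).
pose mu : probability (borel_space R M) R := distribution m Y.
exists mu; split => //.
- rewrite /supported_on -[LHS]/(m (phi @^-1` (~` G))).
  rewrite (_ : _ @^-1` _ = set0) ?measure0//.
  by apply/seteqP; split=> t //=; apply; exact: graph_point_in.
- move=> B mB; rewrite -[LHS]/(m (phi @^-1` B)) mE; last first.
    by rewrite -[_ @^-1` _]setTI; exact: mphi.
  rewrite big_nat [RHS]big_nat; apply: eq_bigr => k hk.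
  by rewrite -[mu _]/(m (phi @^-1` (X `&` W k @^-1` B))) graph_point_preimage.
Qed.

(** The image [n] of an invariant measure under the first projection has a
    distribution function fixed by [transfer], hence equal to [F]; and a measure
    carried by the graph is determined by its first projection. *)
Lemma graph_measure_unique (m : probability (measurableTypeR R) R)
    (nu : probability (borel_space R M) R) :
  (forall t, m `]-oo, t]%classic = (F t)%:E) ->
  supported_on nu G -> is_invariant_measure N X W p nu ->
  forall B : set (borel_space R M), measurable B -> nu B = m (phi @^-1` B).
Proof.
move=> mF nuG nuinv.
pose pi : {mfun borel_space R M >-> measurableTypeR R} :=
  HB.pack (fst : borel_space R M -> measurableTypeR R)
    (isMeasurableFun.Build _ _ _ _ (fst : borel_space R M -> measurableTypeR R)
      (@measurable_fst_borel R M)).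
pose n : probability (measurableTypeR R) R := distribution nu pi.
have nE A : n A = nu (fst @^-1` A) by [].
have mfstP (A : set (measurableTypeR R)) : measurable A ->
    measurable (fst @^-1` A : set (borel_space R M)).
  by move=> mA; rewrite -[_ @^-1` _]setTI; exact: (@measurable_fst_borel R M).
have nu_eq (U V : set (borel_space R M)) : measurable U -> measurable V ->
    U `&` G = V `&` G -> nu U = nu V.
  by move=> mU mV; apply: null_setC_eq => //; exact: measurable_graph.
pose f t := fine (n `]-oo, t]%classic).
have fE t : n `]-oo, t]%classic = (f t)%:E by rewrite /f fineK// fin_num_measure.
have f01 t : 0 <= f t <= 1.
  by rewrite -!lee_fin -fE probability_le1// measure_ge0.
have fout : cdf_on_interval f.
  split=> t ht; apply: EFin_inj; rewrite -fE nE.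
    transitivity (nu set0); last exact: measure0.
    apply: nu_eq => //; first exact: mfstP.
    apply/seteqP; split=> -[u z] /=; last by case.
    move=> [+ [Ju _]].
    move: Ju; rewrite /interpolation_interval/= !in_itv/= => /andP[u1 _] ut.
    by have := lt_le_trans ht (le_trans u1 ut); rewrite ltxx.
  transitivity (nu setT); last exact: probability_setT.
  apply: nu_eq => //; first exact: mfstP.
  apply/seteqP; split=> -[u z] /= [_ [Ju zE]]; split => //.
  move: Ju; rewrite /interpolation_interval/= !in_itv/= => /andP[_ uN].
  exact: le_trans ht.
have fT t : f t = transfer f t.
  apply: EFin_inj; rewrite -fE nE nuinv; last exact: mfstP.
  rewrite /transfer -sumEFin big_nat [RHS]big_nat; apply: eq_bigr => k hk.
  rewrite EFinM -fE nE; congr (_ * _)%E; apply: nu_eq; last 1 first.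
  - apply/seteqP; split=> -[u z] /=; rewrite /affine_map !in_itv/=.
      by move=> [[_]]; rewrite affine_inv_ge.
    by move=> [+ [Ju zE]]; rewrite affine_inv_ge// => h; do !split.
  - rewrite (_ : _ `&` _ = fst @^-1` (J `&` `]-oo, affine_inv k t]%classic)).
      by apply: mfstP; apply: measurableI; exact: measurable_itv.
    apply/seteqP; split=> -[u z] /=; rewrite /affine_map !in_itv/=.
      by move=> [[Ju _]]; rewrite affine_inv_ge.
    by move=> [Ju]; rewrite affine_inv_ge// => h; do !split.
  - exact: mfstP.
have fF := cdf_uniq fout selfsimilar_cdf_out f01 selfsimilar_cdf01 fT
  selfsimilar_cdfE.
have nm (A : set (measurableTypeR R)) : measurable A -> n A = m A.
  apply: probability_cdf_unique => t; rewrite fE fF.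
  exact/esym/mF.
move=> B mB.
have mA : measurable (phi @^-1` B : set (measurableTypeR R)).
  by rewrite -[_ @^-1` _]setTI; exact: mphi.
rewrite -nm// nE; apply: nu_eq => //; first exact: mfstP.
apply/seteqP; split=> -[u z] /= [Bu [Ju zE]]; split => //; move: Bu;
  by rewrite graph_point_id//; rewrite /= in zE *; rewrite zE.
Qed.

Lemma graph_invariant_measure : exists mu : probability (borel_space R M) R,
  [/\ supported_on mu G, is_invariant_measure N X W p mu
    & forall nu : probability (borel_space R M) R,
        supported_on nu G -> is_invariant_measure N X W p nu ->
        forall B : set (borel_space R M), measurable B -> nu B = mu B].
Proof.
have [m [mF mE]] := selfsimilar_measure.
have [mu [muG muinv muE]] := graph_measure_exists mE.
exists mu; split => // nu nuG nuinv B mB.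
by rewrite muE; exact: graph_measure_unique.
Qed.
End GraphMeasure.
End SelfSimilarCDF.
End Cells.

(** * The fractional integral of a fractal interpolation function *)

Lemma fif_functional_equation (R : realType) (M N : nat) (x a d : nat -> R)
    (y : nat -> 'rV[R]_M) (alpha : nat -> R) (q : nat -> R -> 'rV[R]_M)
    (h : R -> 'rV[R]_M) : is_fif N x y a d alpha q h ->
  forall k t, map_index N k -> interpolation_interval N x t ->
  h (affine_map a d k t) = alpha k *: h t + q k t.
Proof.
move=> [_ _ _ [[_ _ _ GE] _]] k t hk Jt.
have : graph_on (interpolation_interval N x) h (ifs_map a d alpha q k (t, h t)).
  by rewrite GE; exists k => //; exists (t, h t).
by move=> [_ /= ->].
Qed.

Unset Implicit Arguments.
Set Strict Implicit.

Theorem theorem4p4 (R : realType) (M N : nat) (M1 : (1 <= M)%N) (N3 : (3 <= N)%N)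
    (x : nat -> R) (y : nat -> 'rV[R]_M)
    (x_incr : forall i, (1 <= i < N)%N -> x i < x i.+1)
    (a d : nat -> R)
    (P_left : forall k, map_index N k -> affine_map a d k (x 1%N) = x k)
    (P_right : forall k, map_index N k -> affine_map a d k (x N) = x k.+1)
    (alpha : nat -> R) (q : nat -> R -> 'rV[R]_M) (h : R -> 'rV[R]_M)
    (h_fif : is_fif N x y a d alpha q h)
    (beta : R) (beta0 : 0 < beta) :
  let Ih := RL_integral (x 1%N) beta h in
  let gamma := fun k => a k `^ beta * alpha k in
  let Q := RL_parameter x a d beta q h in
  let H := ifs_map a d gamma Q in
  is_fif N x (fun i => Ih (x i)) a d gamma Q Ih
  /\ (forall p : nat -> R, is_probability_vector N p ->
      let G := graph_on (interpolation_interval N x) Ih in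
      exists mu : probability (borel_space R M) R,
        [/\ supported_on mu G,
            is_invariant_measure N (ifs_space N x) H p mu
          & forall nu : probability (borel_space R M) R,
              supported_on nu G ->
              is_invariant_measure N (ifs_space N x) H p nu ->
              forall B : set (borel_space R M), measurable B -> nu B = mu B]).
Proof.
move=> Ih gamma Q H.
have [hpar hcont _ _] := h_fif.
have [alpha1 qcont _ _] := hpar.
have h_eq := fif_functional_equation h_fif.
have Icont : {within interpolation_interval N x, continuous Ih}.
  exact: RL_integral_continuous.
have I_eq k t : map_index N k -> interpolation_interval N x t ->
    Ih (affine_map a d k t) = gamma k *: Ih t + Q k t.
  exact: (RL_integral_eq N3 x_incr P_left P_right beta0 hcont qcont h_eq).
have gamma1 k : map_index N k -> `|gamma k| < 1.
  move=> hk; apply: (RL_scale_lt1 N3 x_incr P_left P_right) => //.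
  exact: alpha1.
have J1 : interpolation_interval N x (x 1%N).
  by apply: node_interval => //; rewrite (leq_trans _ N3).
have JN : interpolation_interval N x (x N).
  by apply: node_interval => //; rewrite leqnn andbT (leq_trans _ N3).
split.
  split.
  - split.
    + by move=> k hk; rewrite -ltr_norml; exact: gamma1.
    + exact: (RL_parameter_continuous N3 x_incr P_left P_right beta0 hcont
        qcont h_eq).
    + by move=> k hk; rewrite -(P_left k hk) I_eq// addrC addKr.
    + by move=> k hk; rewrite -(P_right k hk) I_eq// addrC addKr.
  - exact: Icont.
  - by [].
  - exact: (graph_is_unique_attractor N3 x_incr P_left P_right).
move=> p p_prob G.
exact: (graph_invariant_measure N3 x_incr P_left P_right).
Qed.
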